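(* Let $\rho:\Gamma\to G$ be a $(P^+,P^-)$-Anosov representation whose domain of discontinuity $M:=\Omega_\rho$ is a (nonempty) complex curve on which $\rho(\Gamma)$ acts by biholomorphisms, and let $F$ be the free group generated by the holomorphic line bundles $\mathcal{E}^g=g^*T^{1,0}M$ as in the context. Then $\rho(\Gamma)$ acts as a group of automorphisms on $F$. Moreover, $F$ has a structure of a non-trivial (i.e. non-indiscrete) topological space, namely the topology described in the context, such that for any compact set $K\subset F$ the set $$\{\gamma\in\Gamma:\ (\rho(\gamma)K\cap K)\setminus\{\mathcal{O}\}\neq\emptyset\}$$ is finite. In other words, $\rho(\Gamma)$ acts properly discontinuously on $F\setminus\{\mathcal{O}\}$.
   Context: Anosov representations. $\Gamma$ is a finitely generated word hyperbolic group with boundary $\partial_\infty\Gamma$, and $\partial_\infty\Gamma^{(2)}=\partial_\infty\Gamma\times\partial_\infty\Gamma\setminus\{(t,t)\}$. $G$ is a semisimple Lie group, $(P^+,P^-)$ a pair of opposite parabolic subgroups, $\mathcal{F}^\pm=G/P^\pm$. A pair in $\mathcal{F}^+\times\mathcal{F}^-$ is transverse if it lies in the unique open $G$-orbit of the diagonal action (this orbit is $\cong G/(P^+\cap P^-)$). $\hat\Gamma$ is the (essentially unique) proper hyperbolic metric space with an action of $\Gamma\times(\mathbb{R}\rtimes\mathbb{Z}/2\mathbb{Z})$ such that $\Gamma\times\mathbb{Z}/2\mathbb{Z}$ acts isometrically, every orbit map $\Gamma\to\hat\Gamma$ is a quasi-isometry, the $\mathbb{R}$-action $\phi_t$ is free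 with quasi-isometrically embedded orbits, and the induced map $(\tau^+,\tau^-):\hat\Gamma/\mathbb{R}\to\partial_\infty\Gamma^{(2)}$ (endpoints of orbits) is a homeomorphism. A representation $\rho:\Gamma\to G$ is $(P^+,P^-)$-Anosov if there are continuous $\rho$-equivariant maps $\xi^\pm:\partial_\infty\Gamma\to\mathcal{F}^\pm$ such that (1) $(\xi^+(t^+),\xi^-(t^-))$ is transverse for all $(t^+,t^-)\in\partial_\infty\Gamma^{(2)}$; (2) for one (hence any) continuous equivariant family of norms $\|\cdot\|_{\hat m}$, $\hat m\in\hat\Gamma$, on $T_{\xi^+(\tau^+(\hat m))}\mathcal{F}^+$ (resp. $T_{\xi^-(\tau^-(\hat m))}\mathcal{F}^-$) there are $A,a>0$ with $\|e\|_{\phi_{-t}(\hat m)}\le Ae^{-at}\|e\|_{\hat m}$ (resp. $\|e\|_{\phi_t(\hat m)}\le Ae^{-at}\|e\|_{\hat m}$) for all $t\ge0$, $\hat m$, $e$. Domain of discontinuity. $\mathcal{X}=G/H$ with $H$ a parabolic or a symmetric subgroup of $G$. $M=\Omega_\rho\subset\mathcal{X}$ is a domain of discontinuity for $\rho$: an open $\rho(\Gamma)$-invariant subset such that for every compact $K\subset\Omega_\rho$ the set $\{\gamma\in\Gamma:\rho(\gamma)K\cap K\ne\emptyset\}$ is finite. An action of $\rho(\Gamma)$ on a topological space $X$ is called properly discontinuous if for every compact (not necessarily Hausdorff) $K\subset X$ the set $\{\gamma\in\Gamma:\rho(\gamma)K\cap K\neq\emptyset\}$ is finite. The group $F$. On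 $\rho(\Gamma)$ put $g\sim g'$ iff $g(m)=g'(m)$ for all $m\in M$, and let $\overline{\rho(\Gamma)}=\rho(\Gamma)/\sim$. $\mathcal{E}^g=g^*T^{1,0}M$ (pullback of the $(1,0)$-part of $TM\otimes_{\mathbb{R}}\mathbb{C}$) depends only on $[g]$, and distinct classes give distinct generators. $F$ is the group of formal tensor products of the symbols $\mathcal{E}^g,(\mathcal{E}^g)^*,\mathcal{O}$ ($[g]\in\overline{\rho(\Gamma)}$), modulo only the identifications $L\otimes L^*=L^*\otimes L=\mathcal{O}$, $L\otimes\mathcal{O}=\mathcal{O}\otimes L=L$; i.e. $F$ is the free group on $\{\mathcal{E}^g\}_{[g]\in\overline{\rho(\Gamma)}}$ with identity $\mathcal{O}$ (trivial line bundle) and inverses $(\mathcal{E}^g)^{-1}=(\mathcal{E}^g)^*$. Elements are identified with reduced words. The action is $g'\cdot\mathcal{O}=\mathcal{O}$, and $g'$ acts on a word by replacing each letter $\mathcal{E}^{g}$ by $\mathcal{E}^{g'g}$ and each $(\mathcal{E}^g)^*$ by $(\mathcal{E}^{g'g})^*$. Topology on $F$. Let $\widetilde{M}=M\cup\{\mathcal{O}\}$ be the disjoint union of $M$ (standard topology) and an open singleton $\{\mathcal{O}\}$. Fix a base point $m\in M$ and define $\pi:F\to\widetilde{M}$ by $\pi(\mathcal{O})=\mathcal{O}$ and $\pi(w)=g_1(m)$, where $g_1$ is the index of the first letter ($\mathcal{E}^{g_1}$ or $(\mathcal{E}^{g_1})^*$) of the reduced word $w\ne\mathcal{O}$. $F$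 has the initial topology induced by $\pi$: $U\subseteq F$ is open iff $U=\pi^{-1}(V)$ for some open $V\subseteq\widetilde{M}$. *)

(* Defs.v *)
From HB Require Import structures.
From mathcomp Require Import all_boot all_order all_algebra.
From mathcomp Require Import all_classical reals topology normedtype sequences derive.
From mathcomp Require Import complex.

Set Implicit Arguments.
Unset Strict Implicit.
Unset Printing Implicit Defensive.

Import Order.TTheory GRing.Theory Num.Theory.
Import numFieldNormedType.Exports.

Local Open Scope classical_set_scope.
Local Open Scope ring_scope.
Local Open Scope complex_scope.

Record chart (T V : topologicalType) := Chart {
  dom : set T;
  cmap :> T -> V;
  cinv : V -> T;
  chart_open_dom : open dom;
  chart_open_im : open (cmap @` dom);
  chart_cancel : forall x, dom x -> cinv (cmap x) = x;
  chart_continuous : forall x, dom x -> {for x, continuous cmap};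
  chart_inv_continuous : forall y, (cmap @` dom) y -> {for y, continuous cinv}
}.

(* Only meaningful on an open set [U]. *)
Fixpoint Ck (R : numFieldType) (V W : normedModType R) (k : nat) (U : set V)
    (f : V -> W) : Prop :=
  (forall x, U x -> {for x, continuous f}) /\
  match k with
  | 0%N => True
  | k'.+1 => forall v, (forall x, U x -> derivable f x v) /\
                       Ck k' U (fun x => 'D_v f x)
  end.

Definition smooth_on (R : numFieldType) (V W : normedModType R) (U : set V)
  (f : V -> W) : Prop := forall k, Ck k U f.

#[short(type="topGroupType")]
HB.structure Definition TopGroup := {G of Group G & Topological G}.

(* [chart1] is any fixed chart around the identity; it is used to identify the
   Lie algebra T_1 G with 'rV_n. *)
Record lie_group (R : realType) (n : nat) (G : topGroupType) := LieGroup {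
  atlas : set (chart G 'rV[R]_n);
  chart1 : chart G 'rV[R]_n;
  lie_hausdorff : hausdorff_space G;
  lie_second_countable : @second_countable G;
  lie_mul_continuous : continuous (fun p : G * G => (p.1 * p.2)%g);
  lie_inv_continuous : continuous (fun g : G => (g^-1)%g);
  atlas_cover : forall g, exists2 c, atlas c & dom c g;
  atlas_smooth : forall c c', atlas c -> atlas c' ->
    smooth_on (c @` (dom c `&` dom c')) (c' \o cinv c);
  chart1_atlas : atlas chart1;
  chart1_dom : dom chart1 1%g;
  lie_mul_smooth : forall a b c, atlas a -> atlas b -> atlas c ->
    smooth_on [set p : 'rV[R]_n * 'rV[R]_n |
                 [/\ (a @` dom a) p.1, (b @` dom b) p.2
                   & dom c (cinv a p.1 * cinv b p.2)%g]]
              (fun p => c (cinv a p.1 * cinv b p.2)%g);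
  lie_inv_smooth : forall a b, atlas a -> atlas b ->
    smooth_on (a @` (dom a `&` [set g | dom b (g^-1)%g]))
              (fun x => b ((cinv a x)^-1)%g)
}.

Section LieTheory.
Context {R : realType} {n : nat} {G : topGroupType} (L : lie_group R n G).
Local Notation lie := 'rV[R]_n.
Local Notation e := (chart1 L).

(* Differential at 1 of the conjugation by [g]. *)
Definition Ad (g : G) (v : lie) : lie :=
  'D_v (fun x : lie => e (g * cinv e x * g^-1)%g) (e 1%g).

(* Differential at 1 of [g |-> Ad g w] in the direction [v]. *)
Definition bracket (v w : lie) : lie :=
  'D_v (fun x : lie => Ad (cinv e x) w) (e 1%g).

(* Lie algebra of a closed subgroup: initial velocities of its one-parameter
   subgroups. *)
Definition lie_of (P : set G) : set lie :=
  [set v | exists c : R -> G,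
     [/\ continuous c, forall s t, c (s + t) = (c s * c t)%g,
         forall t, P (c t) & is_derive (0 : R) (1 : R) (fun t => e (c t)) v]].

Definition bracket_space (V W : {vspace lie}) : {vspace lie} :=
  (<<[seq bracket v w | v <- vbasis V, w <- vbasis W]>>)%VS.

Definition lie_ideal (V : {vspace lie}) : Prop :=
  forall u v, v \in V -> bracket u v \in V.

Definition lie_solvable (V : {vspace lie}) : Prop :=
  exists k, iter k (fun W => bracket_space W W) V = 0%VS.

Definition semisimple : Prop :=
  forall V, lie_ideal V -> lie_solvable V -> V = 0%VS.

Definition is_subgroup (H : set G) : Prop :=
  [/\ H 1%g, forall g h, H g -> H h -> H (g * h)%g & forall g, H g -> H (g^-1)%g].

(* [ad X] is diagonalizable over [R], i.e. X is conjugate into a Cartan subspace. *)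
Definition hyperbolic_elt (X : lie) : Prop :=
  forall v, exists2 s : seq lie,
    (forall w, w \in s -> exists a : R, bracket X w = a *: w) &
    v = \sum_(w <- s) w.

(* For X in a closed Weyl chamber this is the sum of g_0 and of the root spaces
   g_alpha with alpha(X) >= 0, i.e. a standard parabolic subalgebra p_Theta, and
   -X gives the opposite one; all pairs of opposite parabolic subalgebras arise
   in this way. Parabolic subgroups are the normalizers of these. *)
Definition parabolic_algebra (X : lie) : set lie :=
  [set v | exists2 s : seq lie,
     (forall w, w \in s -> exists2 a : R, 0 <= a & bracket X w = a *: w) &
     v = \sum_(w <- s) w].

Definition parabolic_of (X : lie) : set G :=
  [set g | Ad g @` parabolic_algebra X = parabolic_algebra X].

Definition parabolic (P : set G) : Prop :=
  exists2 X, hyperbolic_elt X & P = parabolic_of X.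

Definition opposite_parabolics (Pp Pm : set G) : Prop :=
  exists X, [/\ hyperbolic_elt X, Pp = parabolic_of X & Pm = parabolic_of (- X)].

Definition smooth_endomap (s : G -> G) : Prop :=
  continuous s /\ forall a b, atlas L a -> atlas L b ->
    smooth_on (a @` (dom a `&` [set g | dom b (s g)])) (fun x => b (s (cinv a x))).

(* (G^s)_0 <= H <= G^s for an involutive automorphism s of G. *)
Definition symmetric_subgroup (H : set G) : Prop :=
  is_subgroup H /\
  exists s : {multiplicative G -> G},
    let Gs := [set g | s g = g] in
    [/\ involutive s, smooth_endomap s,
        connected_component Gs 1%g `<=` H & H `<=` Gs].

End LieTheory.

Section Cosets.
Context {G : topGroupType} (H : set G).

Definition lcoset_set (g : G) : set G := [set (g * h)%g | h in H].

Definition cosets : Type := [set A : set G | exists g, A = lcoset_set g].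
HB.instance Definition _ := Choice.on cosets.

Lemma coset_subproof (g : G) :
  lcoset_set g \in [set A : set G | exists g, A = lcoset_set g].
Proof. by rewrite inE; exists g. Qed.

Definition coset (g : G) : cosets := exist _ (lcoset_set g) (coset_subproof g).

Lemma act_subproof (g : G) (x : cosets) :
  [set (g * a)%g | a in val x] \in [set A : set G | exists g, A = lcoset_set g].
Proof.
rewrite inE; case: x => A /=; rewrite inE => -[k ->]; exists (g * k)%g.
apply/seteqP; split => [_ [_ [h Hh <-] <-]|_ [h Hh <-]] /=.
  by exists h => //; rewrite mulgA.
by exists (k * h)%g; [exists h|rewrite mulgA].
Qed.

Definition act (g : G) (x : cosets) : cosets :=
  exist _ [set (g * a)%g | a in val x] (act_subproof g x).

Lemma actM (g h : G) (x : cosets) : act (g * h)%g x = act g (act h x).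
Proof.
apply/val_inj/seteqP; split => [_ [a xa <-]|_ [_ [a xa <-] <-]] /=.
  by exists (h * a)%g; [exists a|rewrite mulgA].
by exists a => //; rewrite mulgA.
Qed.

Lemma act_inj (g : G) : injective (act g).
Proof.
suff act1 (x : cosets) : act 1%g x = x.
  by move=> x y xy; rewrite -[x]act1 -[y]act1 -(mulVg g) !actM xy.
apply/val_inj/seteqP; split => [_ [a xa <-]|a xa] /=; first by rewrite mul1g.
by exists a => //; rewrite mul1g.
Qed.

Definition stab (x : cosets) : set G := [set g | act g x = x].

Definition coset_open : set_system cosets := [set U | open (coset @^-1` U)].

Lemma coset_openT : coset_open setT.
Proof. exact: openT. Qed.

Lemma coset_openI : setI_closed coset_open.
Proof. by move=> A B oA oB; exact: openI. Qed.

Lemma coset_open_bigU (I : Type) (f : I -> set cosets) :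
  (forall i, coset_open (f i)) -> coset_open (\bigcup_i f i).
Proof. by move=> oF; apply: bigcup_open => i _; exact: oF. Qed.

HB.instance Definition _ := isOpenTopological.Build cosets
  coset_openT coset_openI coset_open_bigU.

End Cosets.

Definition gromov_product (R : realType) (T : Type) (d : T -> T -> R) (o x y : T) : R :=
  (d x o + d y o - d x y) / 2.

Definition gromov_hyperbolic (R : realType) (T : Type) (d : T -> T -> R) : Prop :=
  exists delta : R, forall o x y z,
    Num.min (gromov_product d o x y) (gromov_product d o y z) - delta
      <= gromov_product d o x z.

Definition qi_embedding (R : realType) (T U : Type) (d : T -> T -> R)
    (d' : U -> U -> R) (f : T -> U) : Prop :=
  exists K C : R, [/\ 1 <= K, 0 <= C & forall x y,
    K^-1 * d x y - C <= d' (f x) (f y) <= K * d x y + C].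

Definition quasi_isometry (R : realType) (T U : Type) (d : T -> T -> R)
    (d' : U -> U -> R) (f : T -> U) : Prop :=
  qi_embedding d d' f /\ exists C : R, forall y, exists x, d' (f x) y <= C.

Section WordMetric.
Context (R : realType) {Gamma : groupType} (S : seq Gamma).

Definition spells (w : seq Gamma) (g : Gamma) : Prop :=
  (forall x, x \in w -> x \in S \/ (x^-1)%g \in S) /\ (\prod_(x <- w) x)%g = g.

Definition generates : Prop := forall g, exists w, spells w g.

Definition word_length (g : Gamma) : R :=
  inf [set r | exists2 w, spells w g & r = (size w)%:R].

Definition word_dist (g h : Gamma) : R := word_length (g^-1 * h)%g.

Definition word_hyperbolic : Prop := generates /\ gromov_hyperbolic word_dist.

Definition asymptotic_from (K : R) (u v : nat -> Gamma) : Prop :=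
  exists N, forall i j, (N <= i)%N -> (N <= j)%N ->
    K <= gromov_product word_dist 1%g (u i) (v j).

(* [asymptotic u u] says that [u] converges at infinity. *)
Definition asymptotic (u v : nat -> Gamma) : Prop :=
  forall K, asymptotic_from K u v.

Definition boundary : Type :=
  [set A : set (nat -> Gamma) | exists2 u, asymptotic u u &
     A = [set v | asymptotic v v /\ asymptotic u v]].
HB.instance Definition _ := Choice.on boundary.

Definition boundary_nbhd (a : boundary) (K : R) : set boundary :=
  [set b | exists u v, [/\ val a u, val b v & asymptotic_from K u v]].

Definition boundary_open : set_system boundary :=
  [set U | forall a, U a -> exists K, boundary_nbhd a K `<=` U].

Lemma boundary_openT : boundary_open setT.
Proof. by move=> a _; exists 0. Qed.

Lemma boundary_openI : setI_closed boundary_open.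
Proof.
move=> A B oA oB a [/oA [K KA] /oB [K' KB]]; exists (Num.max K K').
move=> b [u [v [au bv [N HN]]]]; split; [apply: KA|apply: KB]; exists u, v.
  by split=> //; exists N => i j Ni Nj; apply: le_trans (HN i j Ni Nj); rewrite le_max lexx.
by split=> //; exists N => i j Ni Nj; apply: le_trans (HN i j Ni Nj); rewrite le_max lexx orbT.
Qed.

Lemma boundary_open_bigU (I : Type) (f : I -> set boundary) :
  (forall i, boundary_open (f i)) -> boundary_open (\bigcup_i f i).
Proof.
move=> oF a [i _ fa]; have [K KU] := oF i a fa.
by exists K => b /KU fb; exists i.
Qed.

HB.instance Definition _ := isOpenTopological.Build boundary
  boundary_openT boundary_openI boundary_open_bigU.

(* [b] is the image of [a] under the left translation action of [g]. *)
Definition boundary_act (g : Gamma) (a b : boundary) : Prop :=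
  val b = [set (fun k => (g * u k)%g) | u in val a].

Definition boundary2 : set (boundary * boundary) := [set p | p.1 <> p.2].

End WordMetric.

Record flow_space (R : realType) (Gamma : groupType) (S : seq Gamma)
    (X : metricType R) := FlowSpace {
  gact : Gamma -> X -> X;
  flow : R -> X -> X;
  flip : X -> X;
  taup : X -> boundary R S;
  taum : X -> boundary R S;
  fs_proper : forall (x : X) (r : R), compact [set y | mdist x y <= r];
  fs_hyperbolic : gromov_hyperbolic (@mdist R X);
  gact1 : forall x, gact 1%g x = x;
  gactM : forall g h x, gact (g * h)%g x = gact g (gact h x);
  flow0 : forall x, flow 0 x = x;
  flowD : forall s t x, flow (s + t) x = flow s (flow t x);
  flipK : involutive flip;
  gact_flow : forall g t x, gact g (flow t x) = flow t (gact g x);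
  gact_flip : forall g x, gact g (flip x) = flip (gact g x);
  flip_flow : forall t x, flip (flow t x) = flow (- t) (flip x);
  gact_isometry : forall g x y, mdist (gact g x) (gact g y) = mdist x y;
  flip_isometry : forall x y, mdist (flip x) (flip y) = mdist x y;
  flow_continuous : continuous (fun p : R * X => flow p.1 p.2);
  gact_qi : forall x, quasi_isometry (word_dist R S) (@mdist R X) (gact ^~ x);
  flow_free : forall t x, flow t x = x -> t = 0;
  flow_qi : forall x,
    qi_embedding (fun s t : R => `|s - t|) (@mdist R X) (flow ^~ x);
  (* [taup x] and [taum x] are the forward and backward endpoints of the orbit
     of [x], read in the boundary of [Gamma] via the orbit map [gact ^~ x]. *)
  taupP : forall x, exists2 u, val (taup x) u &
    exists C, forall k : nat, mdist (gact (u k) x) (flow k%:R x) <= C;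
  taumP : forall x, exists2 u, val (taum x) u &
    exists C, forall k : nat, mdist (gact (u k) x) (flow (- k%:R) x) <= C;
  (* The map induced by (taup, taum) from X/R to [boundary2] is a homeomorphism
     for the quotient topology. *)
  tau_distinct : forall x, boundary2 (taup x, taum x);
  tau_inj : forall x y,
    (taup x = taup y /\ taum x = taum y) <-> exists t, y = flow t x;
  tau_surj : forall p, boundary2 p -> exists x, p = (taup x, taum x);
  tau_homeo : forall U : set (boundary R S * boundary R S),
    open [set x | U (taup x, taum x)] <->
    exists2 O, open O & O `&` @boundary2 R Gamma S = U `&` @boundary2 R Gamma S
}.

Section Anosov.
Context {R : realType} {n : nat} {G : topGroupType} (L : lie_group R n G).
Context {Gamma : groupType} {S : seq Gamma} {X : metricType R}.
Context (Y : flow_space S X) (rho : {multiplicative Gamma -> G}).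

(* Transversality is membership in the open orbit. It is pinned down as the orbit
   of the base pair (P^+, P^-), whose stabilizer is the intersection of P^+ and
   P^-: when G is disconnected other open orbits may exist. *)
Definition transverse (Pp Pm : set G) (p : cosets Pp * cosets Pm) : Prop :=
  let O := [set q : cosets Pp * cosets Pm |
              exists g, q = (act g (coset Pp 1%g), act g (coset Pm 1%g))] in
  open O /\ O p.

Definition rho_equivariant (P : set G) (xi : boundary R S -> cosets P) : Prop :=
  forall g a b, boundary_act g a b -> xi b = act (rho g) (xi a).

(* T_x(G/P) is identified with the quotient of T_1 G by the Lie algebra of the
   stabilizer of x, through v |-> d/dt exp(tv)x; the differential of the action
   of g is then induced by [Ad g]. A norm on T_x(G/P) is thus a seminorm on
   T_1 G vanishing exactly on that subalgebra. *)
Definition norm_on_tangent (P : set G) (x : cosets P) (N : 'rV[R]_n -> R) : Prop :=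
  [/\ forall v w, N (v + w) <= N v + N w,
      forall (a : R) v, N (a *: v) = `|a| * N v &
      forall v, N v = 0 <-> lie_of L (stab x) v].

Definition equivariant_norms (P : set G) (x : X -> cosets P)
    (N : X -> 'rV[R]_n -> R) : Prop :=
  [/\ forall m, norm_on_tangent (x m) (N m),
      continuous (fun p : X * 'rV[R]_n => N p.1 p.2) &
      forall g m v, N (gact Y g m) (Ad L (rho g) v) = N m v].

Definition anosov (Pp Pm : set G) : Prop :=
  exists (xip : boundary R S -> cosets Pp) (xim : boundary R S -> cosets Pm),
    [/\ continuous xip, continuous xim, rho_equivariant xip, rho_equivariant xim &
     [/\ forall p, boundary2 p -> transverse (xip p.1, xim p.2),
      exists2 N, equivariant_norms (xip \o taup Y) N &
        exists A a : R, [/\ 0 < A, 0 < a & forall t m v, 0 <= t ->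
          N (flow Y (- t) m) v <= A * expR (- (a * t)) * N m v] &
      exists2 N, equivariant_norms (xim \o taum Y) N &
        exists A a : R, [/\ 0 < A, 0 < a & forall t m v, 0 <= t ->
          N (flow Y t m) v <= A * expR (- (a * t)) * N m v]]].

End Anosov.

(* [compact] does not include the Hausdorff condition. *)
Definition properly_discontinuous (Gamma : Type) (T : topologicalType)
    (a : Gamma -> T -> T) (Y : set T) : Prop :=
  forall K, K `<=` Y -> compact K ->
    finite_set [set g | (a g @` K) `&` K !=set0].

Section Domain.
Context {G : topGroupType} {Gamma : groupType} (rho : {multiplicative Gamma -> G}).
Context {H : set G}.

Record domain_of_discontinuity (M : set (cosets H)) : Prop := DomainOfDiscontinuity {
  dd_open : open M;
  dd_invariant : forall g x, M x -> M (act (rho g) x);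
  dd_proper : properly_discontinuous (fun g => act (rho g)) M
}.

End Domain.

(** * Complex curves in G/H and the line bundles g^* T^{1,0} M *)

(* A complex atlas on the open subset [M] of G/H which induces its smooth
   structure: read on G, complex charts are smooth submersions. *)
Record complex_curve (R : realType) (n : nat) (G : topGroupType)
    (L : lie_group R n G) (H : set G) (M : set (cosets H)) := ComplexCurve {
  catlas : set (chart (cosets H) R[i]^o);
  catlas_sub : forall c, catlas c -> dom c `<=` M;
  catlas_cover : forall x, M x -> exists2 c, catlas c & dom c x;
  catlas_holomorphic : forall c c', catlas c -> catlas c' ->
    forall z, (c @` (dom c `&` dom c')) z ->
      derivable (c' \o cinv c : R[i]^o -> R[i]^o) z 1;
  catlas_smooth : forall c a, catlas c -> atlas L a ->
    let U := a @` (dom a `&` [set g | dom c (coset H g)]) in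
    let re := fun x : 'rV[R]_n => complex.Re (c (coset H (cinv a x))) : R in
    let im := fun x : 'rV[R]_n => complex.Im (c (coset H (cinv a x))) : R in
    [/\ smooth_on U re, smooth_on U im &
        forall x, U x -> forall s t : R, exists v, 'D_v re x = s /\ 'D_v im x = t]
}.

Section LineBundles.
Context {R : realType} {n : nat} {G : topGroupType} {L : lie_group R n G}.
Context {H : set G} {M : set (cosets H)} (J : complex_curve L M).
Context {Gamma : groupType} (rho : {multiplicative Gamma -> G}).

Definition acts_by_biholomorphisms : Prop :=
  forall g c c', catlas J c -> catlas J c' ->
    forall z, (c @` (dom c `&` [set x | dom c' (act (rho g) x)])) z ->
      derivable ((fun w => c' (act (rho g) (cinv c w))) : R[i]^o -> R[i]^o) z 1.

Definition chart_at (x : cosets H) (c : chart (cosets H) R[i]^o) : Prop :=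
  catlas J c /\ dom c x.

(* Total space of T^{1,0} M. The (1,0)-vector over [p.1] with coordinates
   [p.2] is p.2 c * (d/dz_c) in each complex chart [c] around [p.1]. *)
Definition T10 : set (cosets H * (chart (cosets H) R[i]^o -> R[i]^o)) :=
  [set p | [/\ M p.1, forall c, ~ chart_at p.1 c -> p.2 c = 0 &
     forall c c', chart_at p.1 c -> chart_at p.1 c' ->
       p.2 c' = 'D_1 (c' \o cinv c : R[i]^o -> R[i]^o) (c p.1) * p.2 c]].

(* Total space of g^* T^{1,0} M. *)
Definition pullback_T10 (g : G) :
    set (cosets H * (cosets H * (chart (cosets H) R[i]^o -> R[i]^o))) :=
  [set p | [/\ M p.1, T10 p.2 & p.2.1 = act g p.1]].

End LineBundles.

Section FreeGroup.
Context {T : choiceType}.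

(* (x, false) is the letter x and (x, true) its formal inverse. *)
Definition linv (a : T * bool) : T * bool := (a.1, ~~ a.2).

Definition lcons (a : T * bool) (w : seq (T * bool)) : seq (T * bool) :=
  if w is b :: w' then if b == linv a then w' else a :: w else [:: a].

Definition reduced (w : seq (T * bool)) : bool :=
  sorted (fun a b => b != linv a) w.

Lemma linvK : involutive linv.
Proof. by case=> x b; rewrite /linv /= negbK. Qed.

Lemma lcons_reduced a w : reduced w -> reduced (lcons a w).
Proof.
case: w => //= b w; case: eqP => [_|/eqP ab] /=; first exact: path_sorted.
by rewrite ab.
Qed.

Lemma lconsK a w : reduced w -> lcons (linv a) (lcons a w) = w.
Proof.
case: w => [|b w] /=; first by rewrite linvK eqxx.
case: eqP => [->|_] /=; last by rewrite linvK eqxx.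
by case: w => //= c w /andP[/negPf cb _]; rewrite cb.
Qed.

Lemma lconsVK a w : reduced w -> lcons a (lcons (linv a) w) = w.
Proof. by rewrite -{1}(linvK a); exact: lconsK. Qed.

Definition wmul (u v : seq (T * bool)) : seq (T * bool) := foldr lcons v u.

Lemma wmul_reduced u v : reduced v -> reduced (wmul u v).
Proof. by move=> rv; elim: u => //= a u IH; exact: lcons_reduced. Qed.

Lemma wmul_lcons a u w : reduced w -> wmul (lcons a u) w = lcons a (wmul u w).
Proof.
case: u => //= b u rw; case: eqP => // ->.
by rewrite lconsVK// wmul_reduced.
Qed.

Lemma wmulA u v w : reduced w -> wmul u (wmul v w) = wmul (wmul u v) w.
Proof. by move=> rw; elim: u => //= a u ->; rewrite wmul_lcons. Qed.

Lemma wmulw0 w : reduced w -> wmul w [::] = w.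
Proof.
elim: w => //= a w IH ra; rewrite IH; last exact: path_sorted ra.
by case: w ra {IH} => //= b w /andP[/negPf ->].
Qed.

Definition winv (u : seq (T * bool)) : seq (T * bool) := rev (map linv u).

Lemma winv_reduced u : reduced u -> reduced (winv u).
Proof.
rewrite /reduced /winv rev_sorted sorted_map; apply: sub_sorted => a b /=.
by apply: contra => /eqP ->; rewrite linvK.
Qed.

Lemma winvK u : winv (winv u) = u.
Proof. by rewrite /winv map_rev revK mapK//; exact: linvK. Qed.

Lemma wmulVw u w : reduced w -> wmul (winv u) (wmul u w) = w.
Proof.
move=> rw; elim: u => //= a u IH.
by rewrite /winv map_cons rev_cons /wmul foldr_rcons lconsK// wmul_reduced.
Qed.

End FreeGroup.

Record freegroup (T : choiceType) := FreeGroup {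
  fword :> seq (T * bool);
  _ : reduced fword
}.

HB.instance Definition _ (T : choiceType) := [isSub for @fword T].
HB.instance Definition _ (T : choiceType) := [Choice of freegroup T by <:].

Section FreeGroupTheory.
Context {T : choiceType}.
Local Notation F := (freegroup T).

Lemma fwordP (u : F) : reduced u. Proof. exact: (valP u). Qed.

Definition fg1 : F := @FreeGroup T [::] isT.
Definition fgM (u v : F) : F := FreeGroup (wmul_reduced u (fwordP v)).
Definition fgV (u : F) : F := FreeGroup (winv_reduced (fwordP u)).

Lemma fgMA : associative fgM.
Proof. by move=> u v w; apply/val_inj; rewrite /= wmulA// fwordP. Qed.

Lemma fg1M : left_id fg1 fgM.
Proof. by move=> u; exact/val_inj. Qed.

Lemma fgM1 : right_id fg1 fgM.
Proof. by move=> u; apply/val_inj; rewrite /= wmulw0// fwordP. Qed.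

Lemma fgVM : left_inverse fg1 fgV fgM.
Proof.
move=> u; apply/val_inj; have := @wmulVw T u [::] isT.
by rewrite /= wmulw0// fwordP.
Qed.

Lemma fgMV : right_inverse fg1 fgV fgM.
Proof.
move=> u; rewrite -[u in fgM u _](_ : fgV (fgV u) = u) ?fgVM//.
by apply/val_inj; rewrite /= winvK.
Qed.

HB.instance Definition _ :=
  isGroup.Build F fgMA fg1M fgM1 fgVM fgMV.

End FreeGroupTheory.

Section ImageGroup.
Context {Gamma G : groupType} (rho : {multiplicative Gamma -> G}).

Definition image_group : Type := range rho.

Lemma image_group_closed : group_closed (fun g => g \in range rho).
Proof.
have rho1 : rho 1%g = 1%g by apply: (mulgI (rho 1%g)); rewrite -gmulfM !mulg1.
split; first by rewrite unfold_in inE; exists 1%g.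
move=> x y; rewrite !unfold_in !inE => -[g _ <-] [h _ <-]; exists (g * h^-1)%g => //.
rewrite gmulfM; congr (_ * _)%g; apply: (mulgI (rho h)).
by rewrite -gmulfM !mulgV.
Qed.

HB.instance Definition _ := SubChoice.on image_group.
HB.instance Definition _ :=
  SubChoice_isSubGroup.Build G _ image_group image_group_closed.

Lemma to_image_subproof (g : Gamma) : rho g \in range rho.
Proof. by rewrite inE; exists g. Qed.

Definition to_image (g : Gamma) : image_group := exist _ (rho g) (to_image_subproof g).

End ImageGroup.

Definition acts_by_automorphisms (K A : groupType) (a : K -> A -> A) : Prop :=
  [/\ forall w, a 1%g w = w, forall g h w, a (g * h)%g w = a g (a h w) &
      forall g, bijective (a g) /\ {morph a g : v w / (v * w)%g}].

(* Disjoint union of [M] and an open singleton, here [None]. *)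
Definition adjoin_point (M : Type) : Type := option M.

Section AdjoinPoint.
Context {M : topologicalType}.
HB.instance Definition _ := Choice.on (adjoin_point M).

Definition adjoin_open : set_system (adjoin_point M) :=
  [set U | open (Some @^-1` U)].

Lemma adjoin_openT : adjoin_open setT.
Proof. exact: openT. Qed.

Lemma adjoin_openI : setI_closed adjoin_open.
Proof. by move=> A B oA oB; exact: openI. Qed.

Lemma adjoin_open_bigU (I : Type) (f : I -> set (adjoin_point M)) :
  (forall i, adjoin_open (f i)) -> adjoin_open (\bigcup_i f i).
Proof. by move=> oF; apply: bigcup_open => i _; exact: oF. Qed.

HB.instance Definition _ := isOpenTopological.Build (adjoin_point M)
  adjoin_openT adjoin_openI adjoin_open_bigU.
End AdjoinPoint.

Section GroupF.
Context {R : realType} {n : nat} {G : topGroupType} {L : lie_group R n G}.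
Context {H : set G} {M : set (cosets H)} (J : complex_curve L M).
Context {Gamma : groupType} (rho : {multiplicative Gamma -> G}).
Local Notation K := (image_group rho).

(* The generators of F are the bundles E^g themselves. *)
Definition bundles : Type := [set E | exists g : K, E = pullback_T10 J (val g)].
HB.instance Definition _ := Choice.on bundles.

Lemma bundle_subproof (g : K) :
  pullback_T10 J (val g) \in [set E | exists g : K, E = pullback_T10 J (val g)].
Proof. by rewrite inE; exists g. Qed.

Definition bundle (g : K) : bundles :=
  exist _ (pullback_T10 J (val g)) (bundle_subproof g).

Lemma bundle_repP (E : bundles) : exists g, bundle g = E.
Proof.
case: E => E iE; have /set_mem[g gE] := iE; exists g.
by apply/val_inj; rewrite /= gE.
Qed.

(* An element g with E = E^g; its class modulo ~ is unique by [bundle_eq]. *)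
Definition bundle_rep (E : bundles) : K := projT1 (cid (bundle_repP E)).

Lemma bundle_repK (E : bundles) : bundle (bundle_rep E) = E.
Proof. exact: projT2 (cid (bundle_repP E)). Qed.

(* The unit 1 is the trivial bundle O, and (E, true) stands for the dual of E. *)
Definition F : Type := freegroup bundles.
HB.instance Definition _ := Group.on F.

Context (D : domain_of_discontinuity rho M).

Lemma act_image_subproof (g : K) (x : cosets H) : M x -> M (act (val g) x).
Proof. by case: g => g gr /=; have /set_mem[k _ <-] := gr; exact: dd_invariant. Qed.

(* The bundle of [g] determines, and is determined by, the restriction of [g]
   to [M]. *)
Lemma bundle_eq (g h : K) :
  bundle g = bundle h <-> forall x, M x -> act (val g) x = act (val h) x.
Proof.
split=> [/(congr1 val) /= gh x Mx|gh].
  suff : pullback_T10 J (val h) (x, (act (val g) x, fun=> 0)) by case.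
  rewrite -gh; split=> //; have Mgx := act_image_subproof g Mx.
  by split=> //= c c' _ _; rewrite mulr0.
apply/val_inj/seteqP; split=> -[x y] /= [/= Mx Ty yE]; split=> //=.
  by rewrite -gh.
by rewrite gh.
Qed.

Definition translate (g : K) (E : bundles) : bundles := bundle (g * bundle_rep E)%g.

Lemma translate_bundle (g h : K) : translate g (bundle h) = bundle (g * h)%g.
Proof.
apply/bundle_eq => x Mx; have /bundle_eq := bundle_repK (bundle h).
by rewrite !actM => ->.
Qed.

Lemma translate_inj (g : K) : injective (translate g).
Proof.
move=> E E' /bundle_eq gEE'; rewrite -[E]bundle_repK -[E']bundle_repK.
by apply/bundle_eq => x Mx; move: (gEE' x Mx); rewrite !actM => /act_inj.
Qed.

Lemma F_act_reduced (g : K) (w : F) :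
  reduced [seq (translate g l.1, l.2) | l <- fword w].
Proof.
rewrite /reduced sorted_map; apply: sub_sorted (fwordP w) => -[x a] [y b] /=.
apply: contra => /eqP yx; apply/eqP; rewrite /linv /= in yx *.
by congr pair; [exact: (translate_inj (congr1 fst yx))|exact: (congr1 snd yx)].
Qed.

(* The letter E^h is replaced by E^(gh), cf. [translate_bundle]. *)
Definition F_act (g : K) (w : F) : F := FreeGroup (F_act_reduced g w).

Definition act_image (g : K) (x : M) : M :=
  exist _ (act (val g) (val x)) (mem_set (act_image_subproof g (set_mem (valP x)))).

Definition F_pi (m : M) (w : F) : adjoin_point M :=
  if fword w is l :: _ then Some (act_image (bundle_rep l.1) m) else None.

Definition F_top (m : M) : Type := initial_topology (F_pi m).
HB.instance Definition _ (m : M) := Topological.on (F_top m).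

End GroupF.

Arguments F_act {R n G L H M} J {Gamma rho} D g w.
Arguments F_top {R n G L H M} J {Gamma rho} D m.

(* Main.v *)
Require Import Defs.
From HB Require Import structures.
From mathcomp Require Import all_boot all_order all_algebra.
From mathcomp Require Import all_classical reals topology normedtype.

Set Implicit Arguments.
Unset Strict Implicit.
Unset Printing Implicit Defensive.

Local Open Scope classical_set_scope.

(** The map [pi] is equivariant away from [O], because the first letter of
    [g . w] is [E^(g g_1)] when that of [w] is [E^(g_1)]. Hence [pi] sends a
    compact [K] of [F] to a compact subset of [M] (plus possibly [O]), and if
    [rho g] moves a nontrivial word of [K] into [K], then it moves a point of
    this compact subset of [M] into it; proper discontinuity on [M] concludes. *)

Section FreeGroupMap.
Context {T U : choiceType} (f : T -> U).
Hypothesis f_inj : injective f.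

Definition map_letter (l : T * bool) : U * bool := (f l.1, l.2).

(** As [f] is injective, renaming letters neither creates nor destroys a cancellation; this is what
    makes renaming compatible with the reduced product. *)
Lemma map_letter_eq_linv a b :
  (map_letter b == linv (map_letter a)) = (b == linv a).
Proof.
case: a b => [x a] [y b]; rewrite /map_letter /linv /= !xpair_eqE.
by rewrite (inj_eq f_inj).
Qed.

Lemma map_lcons a w :
  map map_letter (lcons a w) = lcons (map_letter a) (map map_letter w).
Proof. by case: w => //= b w; rewrite map_letter_eq_linv; case: eqP. Qed.

Lemma map_wmul u v :
  map map_letter (wmul u v) = wmul (map map_letter u) (map map_letter v).
Proof. by elim: u => //= a u <-; rewrite map_lcons. Qed.

End FreeGroupMap.

Section ActionOnF.
Context {R : realType} {n : nat} {G : topGroupType} {L : lie_group R n G}.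
Context {H : set G} {M : set (cosets H)} (J : complex_curve L M).
Context {Gamma : groupType} (rho : {multiplicative Gamma -> G}).
Context (D : domain_of_discontinuity rho M).
Local Notation K := (image_group rho).

Lemma translate1 (E : bundles J rho) : translate (1%g : K) E = E.
Proof. by rewrite /translate mul1g bundle_repK. Qed.

Lemma translateM (g h : K) (E : bundles J rho) :
  translate (g * h)%g E = translate g (translate h E).
Proof. by rewrite [translate h E]/translate (translate_bundle J D) mulgA. Qed.

Lemma F_act1 (w : F J rho) : F_act J D 1%g w = w.
Proof.
apply/val_inj => /=; rewrite -[RHS]map_id; apply: eq_map => -[E b] /=.
by rewrite translate1.
Qed.

Lemma F_actM (g h : K) (w : F J rho) :
  F_act J D (g * h)%g w = F_act J D g (F_act J D h w).
Proof.
apply/val_inj => /=; rewrite -map_comp; apply: eq_map => -[E b] /=.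
by rewrite translateM.
Qed.

Lemma F_act_morph (g : K) : {morph F_act J D g : v w / (v * w)%g}.
Proof.
move=> v w; apply/val_inj.
exact: (map_wmul (translate_inj D (g := g))).
Qed.

Lemma F_act_automorphisms : acts_by_automorphisms (F_act J D).
Proof.
split=> [||g]; [exact: F_act1|exact: F_actM|split; last exact: F_act_morph].
by exists (F_act J D g^-1%g) => w; rewrite -F_actM ?mulVg ?mulgV F_act1.
Qed.

(** [bundle_rep] picks an arbitrary representative, so that of [translate g E] may differ from
    [g * bundle_rep E]; both define the same bundle, hence agree on [M]. *)
Lemma act_bundle_rep_translate (g : K) (E : bundles J rho) (x : cosets H) :
  M x -> act (val (bundle_rep (translate g E))) x =
         act (val g) (act (val (bundle_rep E)) x).
Proof.
move=> Mx; rewrite -actM.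
by have /(bundle_eq J D) -> := bundle_repK (translate g E).
Qed.

Context (m : M).

(* The point of [M] under a word, where the junk value [m] for the trivial word
   keeps the map continuous since [O] is isolated. *)
Definition F_base (w : F_top J D m) : cosets H := val (odflt m (F_pi D m w)).

Lemma F_base_continuous : continuous F_base.
Proof.
apply/continuousP => V oV.
exists [set x : adjoin_point M | V (val (odflt m x))] => //.
(* Openness in [adjoin_point M] is tested on the trace on [M] alone, which here is that of [V]. *)
by exists V.
Qed.

Lemma F_base_in (w : F_top J D m) : M (F_base w).
Proof. exact: set_valP. Qed.

(** The trivial word is excluded: the action fixes it, while [g] may move its default base point
    [m]. *)
Lemma F_base_act (g : K) (w : F_top J D m) : w <> (1%g : F J rho) ->
  F_base (F_act J D g w) = act (val g) (F_base w).
Proof.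
case: w => -[|l w] rw w1; first by case: w1; apply/val_inj.
by rewrite /F_base /= act_bundle_rep_translate //; exact: set_valP.
Qed.

Lemma F_act_proper (C : set (F_top J D m)) : compact C ->
  finite_set [set g : Gamma |
    ((F_act J D (to_image rho g) @` C) `&` C) `\ (1%g : F J rho) !=set0].
Proof.
move=> cC; have : compact (F_base @` C).
  apply: continuous_compact => //.
  exact/continuous_subspaceT/F_base_continuous.
have sM : F_base @` C `<=` M by move=> _ [w _ <-]; exact: F_base_in.
move=> /(dd_proper D sM); apply: sub_finite_set => g [_ [[[w Cw <-] Cgw] gw1]].
(* The action fixes the trivial word, so a nontrivial image comes from a nontrivial word, where
   [F_base] is equivariant. *)
have w1 : w <> (1%g : F J rho).
  by move=> w1; apply: gw1; rewrite w1; exact/val_inj.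
set gw := F_act _ _ _ _ in Cgw; exists (F_base gw); split; last by exists gw.
by exists (F_base w); [exists w|rewrite F_base_act].
Qed.

Lemma F_top_nontrivial :
  exists U : set (F_top J D m), [/\ open U, U <> set0 & U <> setT].
Proof.
(* This is the singleton of the trivial word; the one-letter word [E^1] lies outside it. *)
exists (F_pi D m @^-1` [set None]); split.
- exists [set None] => //; have : open (set0 : set M) by exact: open0.
  by congr open; apply/esym; rewrite -subset0.
- by move/seteqP => [/(_ (1%g : F J rho)) + _]; exact.
- pose w : F J rho := @FreeGroup _ [:: (bundle J (1%g : K), false)] isT.
  by move/seteqP => [_ /(_ w I)].
Qed.

End ActionOnF.

Theorem theorem5p2 (R : realType) (n : nat) (G : topGroupType)
    (L : lie_group R n G) (Gamma : groupType) (S : seq Gamma)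
    (X : metricType R) (Y : flow_space S X)
    (rho : {multiplicative Gamma -> G}) (Pp Pm H : set G)
    (M : set (cosets H)) (J : complex_curve L M)
    (D : domain_of_discontinuity rho M) (m : M) :
  semisimple L ->
  word_hyperbolic R S ->
  opposite_parabolics L Pp Pm ->
  anosov L Y rho Pp Pm ->
  parabolic L H \/ symmetric_subgroup L H ->
  acts_by_biholomorphisms J rho ->
  [/\ acts_by_automorphisms (F_act J D),
      exists U : set (F_top J D m), [/\ open U, U <> set0 & U <> setT],
      forall K : set (F_top J D m), compact K ->
        finite_set [set g : Gamma |
          ((F_act J D (to_image rho g) @` K) `&` K) `\ (1%g : F J rho) !=set0] &
      properly_discontinuous
        (fun (g : Gamma) (w : F_top J D m) =>
           F_act J D (to_image rho g) w : F_top J D m)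
        (~` [set (1%g : F J rho)])].
Proof.
move=> _ _ _ _ _ _; split.
- exact: F_act_automorphisms.
- exact: F_top_nontrivial.
- exact: F_act_proper.
(* [C] avoids the trivial word, so removing that word from the intersection loses nothing. *)
- move=> C C1 /F_act_proper; apply: sub_finite_set => g [w [gCw Cw]].
  by exists w; split => //; exact: C1.
Qed.
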